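(* Let $I \subseteq R=\Bbbk[x_1,\dots,x_n]$ be a monomial ideal of linear-power type and suppose that $\{v_1,\dots,v_r\}$ are the vertices of $\mathrm{SP}(I)$. Let $c$ be the least common multiple of the denominators appearing in the coordinates of $v_1,\dots,v_r$. \begin{enumerate} \item $\mathrm{NP}(I^{(c)}) = c\,\mathrm{SP}(I)$; equivalently, $I^{(kc)} = \overline{\left(I^{(c)}\right)^k}$ for all $k \in \mathbb{N}$. \item $c$ is the smallest positive integer with $\mathrm{NP}(I^{(c)}) = c\,\mathrm{SP}(I)$; more precisely, for any $d \in \mathbb{N}$ satisfying $\mathrm{NP}(I^{(d)}) = d\,\mathrm{SP}(I)$, we have that $c$ divides $d$. \end{enumerate}
   Context: $\Bbbk$ is a field, $R = \Bbbk[x_1,\dots,x_n]$, and $\mathbb{N}$ denotes the positive integers. For $\mathbf{a} \in \mathbb{Z}^n_{\ge 0}$, $x^{\mathbf a} = x_1^{a_1}\cdots x_n^{a_n}$. $\overline{J}$ is the integral closure of an ideal $J$. A monomial ideal $I$ is of linear-power type if $I = \bigcap_{\mathfrak{p}\in \mathrm{Min}(I)} \mathfrak{p}^{\omega_{\mathfrak p}}$ with $\omega_{\mathfrak p} \in \mathbb{N}$ and all minimal primes of $I$ monomial primes (generated by subsets of the variables). The $k$-th symbolic power is $I^{(k)} = \bigcap_{\mathfrak{p} \in \mathrm{Ass}(I)} (I^k R_{\mathfrak{p}} \cap R)$, where $\mathrm{Ass}(I)$ is the set of associated primes of $R/I$. The Newton polyhedron $\mathrm{NP}(I)$ is the convex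 hull in $\mathbb{R}^n$ of $\{\mathbf{a} \in \mathbb{Z}^n_{\ge 0} : x^{\mathbf{a}} \in I\}$. The symbolic polyhedron is $\mathrm{SP}(I) = \bigcap_{\mathfrak{p} \in \mathrm{maxAss}(I)} \mathrm{NP}(R \cap I R_{\mathfrak{p}})$, where $\mathrm{maxAss}(I)$ is the set of maximal elements of $\mathrm{Ass}(I)$ (read as $\mathbb{R}^n_{\ge 0}$ if $I=R$); it is a rational polyhedron. *)

(* Defs.v *)
From HB Require Import structures.
From mathcomp Require Import all_boot all_order all_algebra fraction.
From mathcomp Require Import mpoly.
From mathcomp Require Import boolp classical_sets reals convex.
Set Implicit Arguments.
Unset Strict Implicit.
Unset Printing Implicit Defensive.
Import Order.TTheory GRing.Theory Num.Theory.
Local Open Scope classical_set_scope.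
Local Open Scope ring_scope.

(* Ideals are Prop-valued sets, so that neither decidability nor properness is
   imposed (the boolean [idealr] of the library excludes the unit ideal). *)

(* [S] is meant to be a subring of [A] (all of [A], or a localization inside a
   fraction field), and [J] an ideal of that subring. *)
Definition ideal_in (A : comNzRingType) (S J : set A) : Prop :=
  [/\ J `<=` S,
      J 0,
      forall a b, J a -> J b -> J (a + b)
    & forall s a, S s -> J a -> J (s * a)].

(* Only used with [G `<=` S]; otherwise the intersection is over no set. *)
Definition ideal_span (A : comNzRingType) (S G : set A) : set A :=
  smallest (ideal_in S) G.

Definition is_ideal (A : comNzRingType) (J : set A) : Prop := ideal_in setT J.

Definition ideal_mul (A : comNzRingType) (J K : set A) : set A :=
  ideal_span setT [set x | exists a b, [/\ J a, K b & x = a * b]].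

Definition ideal_pow (A : comNzRingType) (J : set A) (k : nat) : set A :=
  iter k (ideal_mul J) setT.

Definition prime_ideal (A : comNzRingType) (P : set A) : Prop :=
  [/\ is_ideal P, ~ P 1 & forall a b, P (a * b) -> P a \/ P b].

Definition min_primes (A : comNzRingType) (I : set A) : set (set A) :=
  [set P | [/\ prime_ideal P, I `<=` P
    & forall Q, prime_ideal Q -> I `<=` Q -> Q `<=` P -> Q = P]].

(* [set g | I (g * f)] is the annihilator of the class of [f] in A / I. *)
Definition ass_primes (A : comNzRingType) (I : set A) : set (set A) :=
  [set P | prime_ideal P /\ exists f, P = [set g | I (g * f)]].

Definition max_ass_primes (A : comNzRingType) (I : set A) : set (set A) :=
  [set P | ass_primes I P /\ forall Q, ass_primes I Q -> P `<=` Q -> Q = P].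

(* For a domain, A_P is taken as a subring of the fraction field of A. *)
Definition localization (A : idomainType) (P : set A) : set {fraction A} :=
  [set x | exists a s, ~ P s /\ x = @tofrac A a / @tofrac A s].

(* J A_P \cap A *)
Definition loc_contraction (A : idomainType) (J P : set A) : set A :=
  [set a | ideal_span (localization P) [set @tofrac A b | b in J] (@tofrac A a)].

Definition symbolic_pow (A : idomainType) (I : set A) (k : nat) : set A :=
  \bigcap_(P in ass_primes I) loc_contraction (ideal_pow I k) P.

Definition integral_closure (A : comNzRingType) (J : set A) : set A :=
  [set f | exists (m : nat) (a : nat -> A),
    [/\ (0 < m)%N,
        forall i, (1 <= i <= m)%N -> ideal_pow J i (a i)
      & f ^+ m + \sum_(1 <= i < m.+1) a i * f ^+ (m - i) = 0]].

Definition monomial_ideal (K : fieldType) (n : nat) (I : set {mpoly K[n]}) :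
    Prop :=
  exists M : set 'X_{1..n}, I = ideal_span setT [set 'X_[m] | m in M].

Definition monomial_prime (K : fieldType) (n : nat) (P : set {mpoly K[n]}) :
    Prop :=
  prime_ideal P /\
  exists S : {set 'I_n}, P = ideal_span setT [set 'X_i | i in [set` S]].

Definition linear_power_type (K : fieldType) (n : nat)
    (I : set {mpoly K[n]}) : Prop :=
  [/\ monomial_ideal I,
      forall P, min_primes I P -> monomial_prime P
    & exists w : set {mpoly K[n]} -> nat,
        (forall P, min_primes I P -> (0 < w P)%N) /\
        I = \bigcap_(P in min_primes I) ideal_pow P (w P)].

Definition convex_hull (R : realType) (n : nat) (S : set 'rV[R]_n) :
    set 'rV[R]_n :=
  smallest (@convex_set R 'rV[R]_n) S.

Definition exponent_point (R : realType) (n : nat) (m : 'X_{1..n}) : 'rV[R]_n :=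
  \row_i (m i)%:R.

Definition newton_polyhedron (R : realType) (K : fieldType) (n : nat)
    (I : set {mpoly K[n]}) : set 'rV[R]_n :=
  convex_hull [set exponent_point R m | m in [set m : 'X_{1..n} | I 'X_[m]]].
Arguments newton_polyhedron R {K n} I.

(* Newton polyhedra lie in the nonnegative orthant, so intersecting with it only
   matters for the unit ideal, which has no associated prime and for which the
   symbolic polyhedron is the whole orthant by convention. *)
Definition symbolic_polyhedron (R : realType) (K : fieldType) (n : nat)
    (I : set {mpoly K[n]}) : set 'rV[R]_n :=
  [set x : 'rV[R]_n | forall i, 0 <= x 0 i] `&`
  \bigcap_(P in max_ass_primes I) newton_polyhedron R (loc_contraction I P).
Arguments symbolic_polyhedron R {K n} I.

Definition dilate (R : realType) (n : nat) (c : nat) (S : set 'rV[R]_n) :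
    set 'rV[R]_n :=
  [set c%:R *: x | x in S].

(* Vertices of a polyhedron are its extreme points. *)
Definition vertices (R : realType) (n : nat) (S : set 'rV[R]_n) :
    set 'rV[R]_n :=
  [set v | S v /\ forall x y (t : R), S x -> S y -> 0 < t < 1 ->
    v = t *: x + (1 - t) *: y -> x = y].

(* The positive denominator of x in lowest terms; 0 if x is irrational, in which
   case the least common multiple below is 0 as well. *)
Definition denominator (R : realType) (x : R) : nat :=
  xget 0%N [set `|denq q|%N | q in [set q : rat | ratr q = x]].

Definition lcm_denominators (R : realType) (n r : nat)
    (v : 'I_r -> 'rV[R]_n) : nat :=
  \big[lcmn/1%N]_(j < r) \big[lcmn/1%N]_(i < n) denominator (v j 0 i).

(* Main.v *)
(** The minimal primes of [I] are generated by pairwise incomparable sets [S] of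
    variables, and they are also its associated primes; localizing at one of them
    shows that a monomial lies in [symbolic_pow I k] exactly when its degree in
    each [S] is at least [k * b S], where [b S] is the exponent of that prime.
    Likewise the symbolic polyhedron is the set of [x >= 0] with
    [b S <= \sum_(i in S) x_i].  It is the sum of the hull of its vertices and the
    orthant, and its vertices, being unique solutions of rational linear systems,
    are rational.  Scaling by [c] makes them lattice points, which gives
    [NP(I^(c)) = c SP(I)]; conversely an extreme point of a hull of lattice points
    is a lattice point, so [c] divides every such [d].
    For the integral closure, the order of vanishing along each [S] is a valuation,
    which gives one inclusion; for the other, a power [N] of each monomial of
    [I^(kc)] lies in the [N]-th power of [(I^(c))^k], and the determinant trick
    extends this to all polynomials. *)
Require Import Defs.
From mathcomp Require Import all_boot all_order all_algebra fraction perm.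
From mathcomp Require Import mpoly.
From mathcomp Require Import boolp classical_sets reals convex.
From mathcomp Require Import interval_inference ring lra zify.
Set Implicit Arguments.
Unset Strict Implicit.
Unset Printing Implicit Defensive.
Import Order.TTheory GRing.Theory Num.Theory.
Local Open Scope classical_set_scope.
Local Open Scope ring_scope.

(** * Ideals *)

Section Ideals.
Variable A : comNzRingType.
Implicit Types (J L : set A) (a b : A).

Lemma ideal_mem0 J : is_ideal J -> J 0. Proof. by case. Qed.

Lemma ideal_memD J a b : is_ideal J -> J a -> J b -> J (a + b).
Proof. by case=> _ _ + _; apply. Qed.

Lemma ideal_memMl J a b : is_ideal J -> J b -> J (a * b).
Proof. by case=> _ _ _; apply. Qed.

Lemma ideal_memMr J a b : is_ideal J -> J a -> J (a * b).
Proof. by move=> iJ Ja; rewrite mulrC; apply: ideal_memMl. Qed.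

Lemma ideal_memN J a : is_ideal J -> J a -> J (- a).
Proof. by rewrite -mulN1r; apply: ideal_memMl. Qed.

Lemma ideal_mem_sum J (T : Type) (r : seq T) (P : pred T) (F : T -> A) :
  is_ideal J -> (forall i, P i -> J (F i)) -> J (\sum_(i <- r | P i) F i).
Proof.
by move=> iJ JF; elim/big_ind: _ => //; [exact: ideal_mem0|move=> x y; exact: ideal_memD].
Qed.

Lemma ideal_setT : is_ideal (@setT A). Proof. by []. Qed.

Lemma ideal_colon J a : is_ideal J -> is_ideal [set b | J (a * b)].
Proof.
move=> iJ; split=> //=; first by rewrite mulr0; apply: ideal_mem0.
  by move=> x y Jx Jy; rewrite mulrDr; apply: ideal_memD.
by move=> s x _ Jx; rewrite mulrCA; apply: ideal_memMl.
Qed.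

Lemma ideal_span_ideal (G : set A) : is_ideal (ideal_span setT G).
Proof.
split=> //.
- by move=> J [/ideal_mem0 J0 _].
- by move=> a b Ga Gb J [iJ GJ]; apply: ideal_memD => //; [apply: Ga|apply: Gb].
- by move=> s a _ Ga J [iJ GJ]; apply: ideal_memMl => //; apply: Ga.
Qed.

Lemma sub_ideal_span (G : set A) : G `<=` ideal_span setT G.
Proof. by move=> a Ga J [_]; apply. Qed.

Lemma ideal_span_min (G J : set A) :
  is_ideal J -> G `<=` J -> ideal_span setT G `<=` J.
Proof. by move=> iJ GJ a; apply. Qed.

Lemma ideal_mul_ideal J L : is_ideal (ideal_mul J L).
Proof. exact: ideal_span_ideal. Qed.

Lemma mem_ideal_mul J L a b : J a -> L b -> ideal_mul J L (a * b).
Proof. by move=> Ja Lb; apply: sub_ideal_span; exists a, b. Qed.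

Lemma ideal_mul_min J L (X : set A) :
  is_ideal X -> (forall a b, J a -> L b -> X (a * b)) -> ideal_mul J L `<=` X.
Proof. by move=> iX JLX; apply: ideal_span_min => // _ [a [b [? ? ->]]]; apply: JLX. Qed.

Lemma ideal_pow_ideal J k : is_ideal (ideal_pow J k).
Proof. by case: k => [|k]; [exact: ideal_setT|exact: ideal_mul_ideal]. Qed.

Lemma ideal_pow1 J : is_ideal J -> ideal_pow J 1 = J.
Proof.
move=> iJ; apply/seteqP; split=> [|a Ja].
  by apply: ideal_mul_min => // a b Ja _; apply: ideal_memMr.
by rewrite -[a]mulr1; apply: mem_ideal_mul.
Qed.

Lemma mem_ideal_powD J i j a b :
  ideal_pow J i a -> ideal_pow J j b -> ideal_pow J (i + j) (a * b).
Proof.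
elim: i a => [|i IH] a.
  by move=> _ Jb; rewrite add0n; apply: ideal_memMl Jb; apply: ideal_pow_ideal.
move=> Ja Jb.
suff : ideal_pow J i.+1 `<=` [set a | ideal_pow J (i.+1 + j) (b * a)].
  by move=> /(_ a Ja); rewrite /= mulrC.
apply: ideal_mul_min => [|x y Jx Jy]; first by apply: ideal_colon; exact: ideal_pow_ideal.
rewrite /= mulrC -mulrA.
by apply: mem_ideal_mul => //; apply: IH.
Qed.

Lemma mem_ideal_powX J i a m : ideal_pow J i a -> ideal_pow J (i * m) (a ^+ m).
Proof.
move=> Ja; elim: m => [|m IH]; first by rewrite muln0.
by rewrite exprS mulnS; apply: mem_ideal_powD.
Qed.

Lemma sub_ideal_pow J i j : (j <= i)%N -> ideal_pow J i `<=` ideal_pow J j.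
Proof.
move=> /subnK <-; elim: (i - j)%N => // k IH.
apply: subset_trans IH; rewrite addSn.
by apply: ideal_mul_min => [|a b _ Jb]; [|apply: ideal_memMl Jb]; apply: ideal_pow_ideal.
Qed.

(** Bounds a power from above by any multiplicative filtration; it serves for orders along a set of
    variables and for the powers of an ideal themselves. *)
Lemma ideal_pow_filtration (F : nat -> set A) J e k :
  (forall d, is_ideal (F d)) ->
  (forall i j a b, F i a -> F j b -> F (i + j)%N (a * b)) ->
  F 0%N = setT -> J `<=` F e -> ideal_pow J k `<=` F (e * k)%N.
Proof.
move=> iF FM F0 JF; elim: k => [|k IH]; first by rewrite muln0 F0.
apply: ideal_mul_min => // a b /JF Fa /IH Fb.
by rewrite mulnS; apply: FM.
Qed.

Lemma sub_ideal_powD J i j :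
  ideal_pow J (i + j) `<=` ideal_mul (ideal_pow J i) (ideal_pow J j).
Proof.
elim: i => [|i IH] a Ja; first by rewrite -[a]mul1r; apply: mem_ideal_mul.
have iP := ideal_mul_ideal (ideal_pow J i.+1) (ideal_pow J j).
suff : ideal_mul J (ideal_pow J (i + j)) `<=`
    ideal_mul (ideal_pow J i.+1) (ideal_pow J j) by apply.
apply: ideal_mul_min => // {Ja}a b Ja /IH; move: b.
apply: ideal_mul_min; first exact: ideal_colon.
by move=> x y Jx Jy; rewrite /= mulrA; apply: mem_ideal_mul => //; apply: mem_ideal_mul.
Qed.

Lemma ideal_pow_pow J i j : ideal_pow (ideal_pow J i) j = ideal_pow J (i * j).
Proof.
apply/seteqP; split.
  apply: ideal_pow_filtration => //; first exact: ideal_pow_ideal.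
  exact: mem_ideal_powD.
elim: j => [|j IH]; first by rewrite muln0.
rewrite mulnS; apply: subset_trans (@sub_ideal_powD J i (i * j)) _.
apply: ideal_mul_min => [|a b Ja /IH Jb]; first exact: ideal_pow_ideal.
exact: mem_ideal_mul.
Qed.

End Ideals.

(** * Powers of monomial primes *)

Section Filtration.
Variables (K : fieldType) (n : nat).
Implicit Types (S T : {set 'I_n}) (m : 'X_{1..n}) (f g : {mpoly K[n]}).

Definition sdeg S m : nat := \sum_(i in S) m i.

Lemma sdegD S m1 m2 : sdeg S (m1 + m2)%MM = (sdeg S m1 + sdeg S m2)%N.
Proof. by rewrite /sdeg -big_split; apply: eq_bigr => i _; rewrite mnmDE. Qed.

Lemma sdegMn S m k : sdeg S (m *+ k)%MM = (sdeg S m * k)%N.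
Proof. by rewrite /sdeg big_distrl; apply: eq_bigr => i _; rewrite mulmnE. Qed.

Lemma sdeg_subset S T m : S \subset T -> (sdeg S m <= sdeg T m)%N.
Proof.
move=> ST; rewrite [sdeg T m](big_setID S) /= (finset.setIidPr ST).
exact: leq_addr.
Qed.

Lemma sdeg1 S i : sdeg S U_(i) = (i \in S).
Proof.
have [iS|iS] := boolP (i \in S); rewrite /sdeg; last first.
  by rewrite big1 // => j jS; rewrite mnm1E; case: eqP iS => // ->; rewrite jS.
rewrite (bigD1 i) //= mnm1E eqxx big1 // => j /andP[_ ji].
by rewrite mnm1E eq_sym (negbTE ji).
Qed.

(* The [e]-th power of the prime generated by the variables indexed by [S]. *)
Definition Fil S (e : nat) : set {mpoly K[n]} :=
  [set f | forall m, m \in msupp f -> (e <= sdeg S m)%N].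

Lemma Fil0 S : Fil S 0 = setT.
Proof. by apply/seteqP; split. Qed.

Lemma Fil_ideal S e : is_ideal (Fil S e).
Proof.
split=> //; first by move=> m; rewrite msupp0.
  by move=> f g Ff Fg m /msuppD_le; rewrite mem_cat => /orP[/Ff|/Fg].
move=> f g _ Fg m /msuppM_le /allpairsP[[m1 m2] /= [_ m2g ->]].
by rewrite sdegD (leq_trans (Fg _ m2g)) ?leq_addl.
Qed.

Lemma FilM S d e f g : Fil S d f -> Fil S e g -> Fil S (d + e) (f * g).
Proof.
move=> Ff Fg m /msuppM_le /allpairsP[[m1 m2] /= [m1f m2g ->]].
by rewrite sdegD leq_add ?Ff ?Fg.
Qed.

Lemma sub_Fil S d e : (d <= e)%N -> Fil S e `<=` Fil S d.
Proof. by move=> de f Ff m /Ff; apply: leq_trans. Qed.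

Lemma FilX S e m : Fil S e 'X_[m] <-> (e <= sdeg S m)%N.
Proof.
split=> [|em m']; first by apply; rewrite msuppX mem_head.
by rewrite msuppX inE => /eqP ->.
Qed.

Lemma FilMX S e m f : Fil S (e + sdeg S m) ('X_[m] * f) -> Fil S e f.
Proof.
move=> Ff m' m'f; rewrite -(leq_add2r (sdeg S m)) -sdegD; apply: Ff.
by rewrite mulrC (perm_mem (msuppMX _ _)); apply/mapP; exists m' => //; rewrite addmC.
Qed.

(** [f0] is the lowest form of [f], made of its terms of degree [e] in [S]; if it vanished, every
    term would have degree above [e]. *)
Lemma Fil_decomp S e f : Fil S e f -> ~ Fil S e.+1 f ->
  exists2 f0, f0 != 0 /\ (forall m, m \in msupp f0 -> sdeg S m = e)
            & Fil S e.+1 (f - f0).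
Proof.
move=> Ff nFf; pose f0 := \sum_(m <- msupp f | sdeg S m == e) f@_m *: 'X_[m].
have f0E m : f0@_m = if sdeg S m == e then f@_m else 0.
  rewrite raddf_sum /= big_mkcond /=.
  have -> : \sum_(i <- msupp f) (if sdeg S i == e then (f@_i *: 'X_[i])@_m else 0)
     = \sum_(i <- msupp f) (if sdeg S m == e then (f@_i *: 'X_[i])@_m else 0).
    apply: eq_bigr => i _; rewrite mcoeffZ mcoeffX; case: (i =P m) => [->//|_].
    by rewrite mulr0; do 2 case: ifP.
  case: ifP => _; last by rewrite big1.
  by rewrite [in RHS](mpolyE f) raddf_sum.
have supp0 m : m \in msupp f0 -> sdeg S m = e.
  by rewrite mcoeff_msupp f0E; case: (sdeg S m =P e) => // _; rewrite eqxx.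
exists f0 => //; last first.
  move=> m; rewrite mcoeff_msupp mcoeffB f0E; case: (sdeg S m =P e) => [_|me].
    by rewrite subrr eqxx.
  rewrite subr0 -mcoeff_msupp => /Ff; rewrite leq_eqVlt => /orP[/eqP//|//].
  by move=> em; case: me.
split=> //; apply: contra_notN nFf => /eqP f00 m mf.
move: (Ff m mf); rewrite leq_eqVlt => /orP[/eqP em|//].
move: (f0E m); rewrite f00 mcoeff0 -em eqxx => /esym/eqP.
by rewrite mcoeff_eq0 mf.
Qed.

Lemma Fil_order S e f : ~ Fil S e f ->
  exists2 d, (d < e)%N & Fil S d f /\ ~ Fil S d.+1 f.
Proof.
elim: e => [|e IH] nF; first by case: nF; rewrite Fil0.
have [/IH[d de ?]|F] := pselect (~ Fil S e f); first by exists d => //; lia.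
by exists e => //; split=> //; apply: contrapT.
Qed.

(* The order of vanishing is a valuation: the lowest forms of [f] and [g] have a
   nonzero product, as the polynomial ring is a domain. *)
Lemma Fil_valuation S d e f g :
  ~ Fil S d.+1 f -> ~ Fil S e.+1 g -> ~ Fil S (d + e).+1 (f * g).
Proof.
move=> /Fil_order[d' dd' [Ff nFf]] /Fil_order[e' ee' [Fg nFg]] Ffg.
have {Ffg} : Fil S (d' + e').+1 (f * g) by apply: sub_Fil Ffg; lia.
have [f0 [f0_neq0 f0S] Ff0] := Fil_decomp Ff nFf.
have [g0 [g0_neq0 g0S] Fg0] := Fil_decomp Fg nFg.
move=> Ffg.
have iF := Fil_ideal S (d' + e').+1.
have F0 : Fil S (d' + e').+1 (f0 * g0).
  (* Passing to lowest forms changes the product only by terms of order above [d' + e']. *)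
  have -> : f0 * g0 = f * g + - ((f - f0) * g + f0 * (g - g0)) by ring.
  apply: (ideal_memD iF) => //; apply: (ideal_memN iF); apply: (ideal_memD iF).
    by rewrite -addSn; apply: FilM.
  by rewrite -addnS; apply: FilM => // m /f0S ->.
have fg_neq0 : f0 * g0 != 0 by rewrite mulf_neq0.
have mfg := mlead_supp fg_neq0.
move: (F0 _ mfg); move/msuppM_le: mfg => /allpairsP[[m1 m2] /= [/f0S m1S /g0S m2S ->]].
by rewrite sdegD m1S m2S ltnn.
Qed.

Lemma Fil_prime S : prime_ideal (Fil S 1).
Proof.
split; first exact: Fil_ideal.
  move=> /(_ 0%MM); rewrite msupp1 inE eqxx /sdeg big1 // => [/(_ isT)//|i _].
  by rewrite mnm0E.
move=> f g Ffg; apply: contrapT => /not_orP[nf ng].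
exact: (Fil_valuation nf ng).
Qed.

(** This is what permits normalizing the exponent of the zero prime, which no variable generates. *)
Lemma Fil_set0 e : (0 < e)%N -> Fil finset.set0 e = [set 0].
Proof.
move=> e0; apply/seteqP; split=> [f Ff|_ -> m]; last by rewrite msupp0.
apply: msuppnil0; case E: (msupp f) => [//|m s]; have := Ff m.
by rewrite E mem_head /sdeg big_set0 => /(_ isT); rewrite leqNgt e0.
Qed.

(** A monomial of degree [k] in [S] is a product of [k] variables of [S] and a cofactor; the other
    inclusion is that of a filtration. *)
Lemma ideal_pow_span S e :
  ideal_pow (ideal_span setT [set 'X_i | i in [set` S]]) e = Fil S e.
Proof.
apply/seteqP; split.
  rewrite -[X in Fil S X]mul1n; apply: ideal_pow_filtration.
  - exact: Fil_ideal.
  - by move=> *; apply: FilM.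
  - exact: Fil0.
  apply: ideal_span_min; first exact: Fil_ideal.
  move=> _ [i /= iS <-]; apply/FilX.
  by rewrite sdeg1 iS.
set P := ideal_span _ _.
have mon m : ideal_pow P (sdeg S m) 'X_[m].
  rewrite mpolyXE_id (bigID (mem S)) /=; apply: (ideal_memMr _ (ideal_pow_ideal P _)).
  rewrite /sdeg; elim/big_rec2: _ => [//|i k p iS Pp].
  apply: mem_ideal_powD => //; rewrite -[X in ideal_pow P X]mul1n.
  apply: mem_ideal_powX; rewrite ideal_pow1; last exact: ideal_span_ideal.
  by apply: sub_ideal_span; exists i.
move=> f Ff; rewrite (mpolyE f) big_seq.
apply: (ideal_mem_sum _ (ideal_pow_ideal P e)) => m mf.
rewrite -mul_mpolyC; apply: (ideal_memMl _ (ideal_pow_ideal P _)).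
exact: sub_ideal_pow (Ff m mf) _ (mon m).
Qed.

Lemma Fil1_subset S T : Fil S 1 `<=` Fil T 1 -> S \subset T.
Proof.
move=> ST; apply/fintype.subsetP => i iS.
have /ST/FilX : Fil S 1 'X_i by apply/FilX; rewrite sdeg1 iS.
by rewrite sdeg1; case: (i \in T).
Qed.

End Filtration.
Arguments Fil_ideal {K n}.
Arguments Fil0 {K n}.
Arguments Fil_prime {K n}.

(** * Symbolic powers *)

Lemma prime_ideal_prod (A : comNzRingType) (P : set A) (T : Type) (r : seq T)
    (F : T -> A) :
  prime_ideal P -> P (\prod_(i <- r) F i) -> exists i, P (F i).
Proof.
move=> [iP P1 PM]; elim: r => [|i r IH]; first by rewrite big_nil.
by rewrite big_cons => /PM[|//] Pi; exists i.
Qed.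

Lemma prime_ideal_exp (A : comNzRingType) (P : set A) a k :
  prime_ideal P -> P (a ^+ k) -> P a.
Proof.
move=> [iP P1 PM]; elim: k => [//|k IH].
by rewrite exprS => /PM[].
Qed.

Lemma loc_contractionE (A : idomainType) (J P : set A) :
  is_ideal J -> prime_ideal P ->
  loc_contraction J P = [set a | exists2 s, ~ P s & J (s * a)].
Proof.
move=> iJ [iP P1 PM]; have Pn0 s : ~ P s -> @tofrac A s != 0.
  by rewrite tofrac_eq0; apply: contra_notN => /eqP ->; apply: ideal_mem0.
apply/seteqP; split=> a.
  (* The extension of [J] to the localization consists of the fractions with numerator in [J]. *)
  pose X := [set x : {fraction A} |
    exists b s, [/\ J b, ~ P s & x = tofrac b / tofrac s]].
  have iX : ideal_in (localization P) X.
    split.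
    - by move=> _ [b [s [_ Ps ->]]]; exists b, s.
    - by exists 0, 1; split=> //; [apply: ideal_mem0|rewrite tofrac0 mul0r].
    - move=> _ _ [b [s [Jb Ps ->]]] [c [t [Jc Pt ->]]].
      exists (b * t + c * s), (s * t); split.
      + by apply: ideal_memD => //; apply: ideal_memMr.
      + by case/PM.
      + by rewrite tofracD !tofracM addf_div ?Pn0.
    - move=> _ _ [c [t [Pt ->]]] [b [s [Jb Ps ->]]].
      exists (c * b), (t * s); split; first exact: ideal_memMl.
        by case/PM.
      by rewrite !tofracM mulf_div.
  move=> /(_ X) []; first by split=> // _ [b Jb <-]; exists b, 1; rewrite tofrac1 divr1.
  move=> b [s [Jb Ps ab]]; exists s => //.
  suff -> : s * a = b by [].
  by apply/eqP; rewrite -tofrac_eq tofracM ab mulrC divfK ?Pn0.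
move=> [s Ps Jsa] X [[_ _ _ XM] JX].
have -> : tofrac a = (tofrac 1 / tofrac s) * tofrac (s * a).
  by rewrite tofrac1 tofracM mul1r mulKf ?Pn0.
by apply: XM; [exists 1, s|apply: JX; exists (s * a)].
Qed.

(** * Symbolic powers of intersections of powers of monomial primes *)

Section Intersection.
Variables (K : fieldType) (n : nat).
Implicit Types (S T : {set 'I_n}) (m : 'X_{1..n}) (f g : {mpoly K[n]}).
Implicit Types (b : {set 'I_n} -> nat).

(** A zero value of [b] imposes no condition: the components are the sets with [b S > 0], and
    [b = 0] gives the unit ideal. *)
Definition Ib b : set {mpoly K[n]} := [set f | forall S, Fil S (b S) f].

Lemma Ib_ideal b : is_ideal (Ib b).
Proof.
split=> //.
- by move=> S; exact: (ideal_mem0 (Fil_ideal S _)).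
- by move=> f g If Ig S; exact: (ideal_memD (Fil_ideal S _) (If S) (Ig S)).
- by move=> f g _ Ig S; exact: (ideal_memMl _ (Fil_ideal S _) (Ig S)).
Qed.

Lemma ideal_pow_Ib b k : ideal_pow (Ib b) k `<=` Ib (fun S => k * b S)%N.
Proof.
move=> f If S; rewrite mulnC; move: f If; apply: ideal_pow_filtration.
- exact: Fil_ideal.
- by move=> *; apply: FilM.
- exact: Fil0.
- by move=> f; apply.
Qed.

Lemma IbX b m : Ib b 'X_[m] <-> forall S, (b S <= sdeg S m)%N.
Proof. by split=> H S; apply/FilX/H. Qed.

(* A nonzero [b S] is the exponent of the minimal prime generated by [S]; the
   exponent of the zero prime is immaterial and is normalized to 1. *)
Definition exponents b :=
  (b finset.set0 <= 1)%N /\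
  forall S T, (0 < b S)%N -> (0 < b T)%N -> S \subset T -> S = T.

Lemma monomial_outside S N : exists2 m, sdeg S m = 0%N
  & forall T, ~~ (T \subset S) -> (N <= sdeg T m)%N.
Proof.
exists [multinom (if i \in S then 0 else N)%N | i < n].
  by rewrite /sdeg big1 // => i iS; rewrite mnmE iS.
move=> T /subsetPn[i iT iS]; rewrite /sdeg (bigD1 i) //= mnmE (negbTE iS).
exact: leq_addr.
Qed.

(** Such a monomial is invertible at the prime of [S] and lies in all other components, as
    incomparability gives each of their sets a variable outside [S]. *)
Lemma monomial_outside_exponents b S : exponents b -> (0 < b S)%N ->
  exists2 m, sdeg S m = 0%N & forall T, T != S -> (b T <= sdeg T m)%N.
Proof.
move=> [_ bA] bS; have [m mS mT] := monomial_outside S (\max_T b T).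
exists m => // T TS; have [->//|bT] := posnP (b T).
apply: leq_trans (mT T _); first exact: (leq_bigmax T).
by apply: contraNN TS => /(bA _ _ bT bS) ->.
Qed.

Lemma ass_primes_Ib b : exponents b ->
  ass_primes (Ib b) = [set P | exists2 S, (0 < b S)%N & P = Fil S 1].
Proof.
move=> hb; apply/seteqP; split=> P; last first.
  move=> [S bS ->]; split; first exact: Fil_prime.
  have [m mS mT] := monomial_outside_exponents hb bS.
  (* The order of ['X_[m']] along [S] is one less than [b S], so multiplying by ['X_[m + m']] leads
     into [Ib b] exactly from positive order. For empty [S] this requires [b S = 1]. *)
  have [m' m'S] : exists m', (sdeg S m').+1 = b S.
    have [S0|[i iS]] := set_0Vmem S.
      exists 0%MM; rewrite S0 /sdeg big_set0.
      by case: hb => b0 _; move: bS b0; rewrite S0; lia.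
    by exists (U_(i) *+ (b S).-1)%MM; rewrite sdegMn sdeg1 iS mul1n prednK.
  exists 'X_[m + m']; apply/seteqP; split=> g.
    move=> Fg /= T; have [->|TS] := eqVneq T S.
      by rewrite -m'S -add1n; apply: FilM => //; apply/FilX; rewrite sdegD leq_addl.
    apply: (ideal_memMl _ (Fil_ideal T _)); apply/FilX.
    by rewrite sdegD (leq_trans (mT T TS)) ?leq_addr.
  rewrite /= => /(_ S) Fg; apply: (FilMX (m := (m + m')%MM)).
  by rewrite mulrC sdegD mS add0n add1n m'S.
move=> [pP [f Pf]].
(* The annihilator [P] is the intersection over [S] of the annihilators of [f] modulo the
   components; being prime, it contains one of these finitely many ideals. *)
have [S PS] : exists S, forall g, Fil S (b S) (g * f) -> P g.
  apply: contrapT => /forallNP nS.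
  have /choice[h hP] : forall S, exists g, Fil S (b S) (g * f) /\ ~ P g.
    move=> S; have /existsNP[g /not_implyP gP] := nS S.
    by exists g.
  have [|S] := prime_ideal_prod (r := index_enum _) (F := h) pP.
    rewrite Pf /= => S; rewrite (bigD1 S) //= mulrAC.
    by apply: (ideal_memMr _ (Fil_ideal S _)); case: (hP S).
  by case: (hP S).
have nFf : ~ Fil S (b S) f.
  by move=> Ff; case: pP => _ + _; apply; apply: PS; rewrite mul1r.
have bS : (0 < b S)%N by rewrite lt0n; apply: contra_notN nFf => /eqP ->; rewrite Fil0.
exists S => //; apply/seteqP; split=> g.
  rewrite {1}Pf /= => /(_ S) Fgf; apply: contrapT => nFg.
  have nFf' : ~ Fil S (b S).-1.+1 f by rewrite prednK.
  by apply: Fil_valuation nFg nFf' _; rewrite add0n prednK.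
move=> Fg; apply: (@prime_ideal_exp _ _ _ (b S)) => //; apply: PS.
apply: (ideal_memMr _ (Fil_ideal S _)).
rewrite -(ideal_pow_span K) -[X in ideal_pow _ X]mul1n.
by apply: mem_ideal_powX; rewrite ideal_pow_span.
Qed.

Lemma max_ass_primes_Ib b : exponents b ->
  max_ass_primes (Ib b) = [set P | exists2 S, (0 < b S)%N & P = Fil S 1].
Proof.
move=> hb; rewrite /max_ass_primes ass_primes_Ib //.
apply/seteqP; split=> P /=; first by case.
move=> [S bS ->]; split; first by exists S.
by move=> _ [T bT ->] /Fil1_subset ST; case: hb => _ /(_ S T bS bT ST) ->.
Qed.

Lemma ideal_pow_scale (A : comNzRingType) (J L : set A) s k a :
  (forall x, J x -> L (s * x)) -> ideal_pow J k a -> ideal_pow L k (s ^+ k * a).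
Proof.
move=> JL; elim: k a => [//|k IH] a.
have iL := ideal_colon (s ^+ k.+1) (ideal_pow_ideal L k.+1).
move: a; apply: (ideal_mul_min iL) => x y Jx /IH Ly /=.
by rewrite exprS mulrACA; apply: mem_ideal_mul => //; apply: JL.
Qed.

(** By the valuation, denominators do not change the order along [S]. Conversely, the [k]-th power
    of a monomial invertible at [S] and lying in the other components is a suitable denominator. *)
Lemma loc_contraction_pow_Ib b S k : exponents b -> (0 < b S)%N ->
  loc_contraction (ideal_pow (Ib b) k) (Fil S 1) = Fil S (k * b S).
Proof.
move=> hb bS.
rewrite loc_contractionE; [|exact: ideal_pow_ideal|exact: Fil_prime].
apply/seteqP; split=> f /=.
  move=> [s nFs /ideal_pow_Ib/(_ S) Fsf]; have [//|k0] := posnP (k * b S).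
    by move=> ->; rewrite Fil0.
  apply: contrapT => nFf; rewrite -(prednK k0) in Fsf nFf.
  exact: Fil_valuation nFs nFf Fsf.
move=> Ff; have [m mS mT] := monomial_outside_exponents hb bS.
exists ('X_[m] ^+ k).
  by rewrite mpolyXn => /FilX; rewrite sdegMn mS.
apply: (@ideal_pow_scale _ (Fil S (b S))); last first.
  by rewrite -(ideal_pow_span K) ideal_pow_pow ideal_pow_span mulnC.
move=> x Fx T; have [->|TS] := eqVneq T S.
  exact: (ideal_memMl _ (Fil_ideal S _)).
apply: (ideal_memMr _ (Fil_ideal T _)); apply/FilX; exact: mT.
Qed.

Lemma loc_contraction_Ib b S : exponents b -> (0 < b S)%N ->
  loc_contraction (Ib b) (Fil S 1) = Fil S (b S).
Proof.
move=> hb bS; rewrite -{1}(ideal_pow1 (Ib_ideal b)).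
by rewrite loc_contraction_pow_Ib // mul1n.
Qed.

Lemma symbolic_pow_Ib b k : exponents b ->
  symbolic_pow (Ib b) k = Ib (fun S => k * b S)%N.
Proof.
move=> hb; rewrite /symbolic_pow ass_primes_Ib //; apply/seteqP; split=> f.
  move=> If S; have [->|bS] := posnP (b S); first by rewrite muln0 Fil0.
  by rewrite -loc_contraction_pow_Ib //; apply: (If (Fil S 1)); exists S.
by move=> If _ [S bS ->]; rewrite loc_contraction_pow_Ib //; apply: If.
Qed.

Lemma linear_power_type_Ib (I : set {mpoly K[n]}) : linear_power_type I ->
  exists2 b, exponents b & I = Ib b.
Proof.
move=> [_ monI [w [w_gt0 Iw]]].
(* The exponent is 0 away from the minimal primes; for the zero prime, 1 replaces [w] with no effect
   on the power. *)
pose b S := if `[< min_primes I (Fil S 1) >] then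
              if S == finset.set0 then 1%N else w (Fil S 1) else 0%N.
have bP S : (0 < b S)%N <-> min_primes I (Fil S 1).
  rewrite /b; case: asboolP => [mS|mS]; last by split.
  by split=> // _; case: ifP => // _; apply: w_gt0.
have minP P : min_primes I P -> exists2 S, P = Fil S 1 & min_primes I (Fil S 1).
  move=> mP; have [_ [S PS]] := monI P mP.
  suff PF : P = Fil S 1 by exists S => //; rewrite -PF.
  by rewrite -(ideal_pow_span K) ideal_pow1 //; apply: ideal_span_ideal.
have powP S : min_primes I (Fil S 1) ->
    ideal_pow (Fil S 1) (w (Fil S 1)) = Fil S (b S) :> set {mpoly K[n]}.
  move=> mS; rewrite -[in LHS](ideal_pow_span K) ideal_pow_pow mul1n !ideal_pow_span.
  rewrite /b asboolT //; case: eqP => // S0; rewrite S0 in mS *.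
  by rewrite [LHS]Fil_set0 ?w_gt0 // [RHS]Fil_set0.
exists b.
  split; first by rewrite /b; case: ifP => // _; rewrite eqxx.
  move=> S T /bP [_ IS _] /bP [_ _ minT] ST; apply/eqP.
  rewrite finset.eqEsubset ST /=; apply: (@Fil1_subset K n).
  suff -> : Fil S 1 = Fil T 1 :> set {mpoly K[n]} by [].
  apply: minT (Fil_prime S) IS _.
  by move=> f Ff m /Ff/leq_trans; apply; apply: sdeg_subset.
rewrite {1}Iw; apply/seteqP; split=> f If.
  move=> S; have [->|/bP mS] := posnP (b S); first by rewrite Fil0.
  by rewrite -powP //; apply: (If (Fil S 1)).
by move=> _ /minP[S -> mS]; rewrite powP //; apply: If.
Qed.

End Intersection.

(** * Polyhedra cut out by subset sums *)

Section Polyhedron.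
Variables (F : realFieldType) (n : nat).
Implicit Types (S : {set 'I_n}) (x y u v : 'rV[F]_n) (b : {set 'I_n} -> nat).

Definition ssum S x : F := \sum_(i in S) x 0 i.

Lemma ssumD S x y : ssum S (x + y) = ssum S x + ssum S y.
Proof. by rewrite -big_split; apply: eq_bigr => i _; rewrite mxE. Qed.

Lemma ssumZ S t x : ssum S (t *: x) = t * ssum S x.
Proof. by rewrite /ssum big_distrr; apply: eq_bigr => i _; rewrite mxE. Qed.

Lemma ssumN S x : ssum S (- x) = - ssum S x.
Proof. by rewrite -scaleN1r ssumZ mulN1r. Qed.

(* [inl i] stands for the constraint [0 <= x_i] and [inr S] for [b S <= ssum S x]. *)
Definition csupp (c : 'I_n + {set 'I_n}) : {set 'I_n} :=
  match c with inl i => [set i]%SET | inr T => T end.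

Definition cbound b (c : 'I_n + {set 'I_n}) : nat :=
  match c with inl _ => 0%N | inr T => b T end.

Definition Q b : set 'rV[F]_n :=
  [set x | forall c, (cbound b c)%:R <= ssum (csupp c) x].

Definition tight b x c : bool := ssum (csupp c) x == (cbound b c)%:R.

Definition tight_direction b x u : Prop :=
  forall c, tight b x c -> ssum (csupp c) u = 0.

(** Vertices in terms of linear algebra: the tight constraints have full rank. This form passes
    between [rat] and larger fields. *)
Definition tight_vertex b x : Prop :=
  Q b x /\ forall u, tight_direction b x u -> u = 0.

Lemma ssum1 i x : ssum (csupp (inl i)) x = x 0 i.
Proof. by rewrite /ssum /= big_set1. Qed.

Lemma Q_ge0 b x : Q b x -> forall i, 0 <= x 0 i.
Proof. by move=> Qx i; have := Qx (inl i); rewrite ssum1. Qed.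

Lemma QP b x :
  Q b x <-> (forall i, 0 <= x 0 i) /\ forall S, (b S)%:R <= ssum S x.
Proof.
split=> [Qx|[x0 xS] [i|S]]; [|by rewrite ssum1|exact: xS].
by split=> [i|S]; [exact: Q_ge0 Qx i|exact: (Qx (inr S))].
Qed.

Lemma tight_directionN b x u : tight_direction b x u -> tight_direction b x (- u).
Proof. by move=> xu c /xu; rewrite ssumN => ->; rewrite oppr0. Qed.

(** Among the constraints that decrease along [u], the one with the smallest ratio [q] of slack to
    slope is met first, and [t] is this ratio. *)
Lemma tight_step_lt0 b x u c0 : Q b x -> tight_direction b x u ->
  ssum (csupp c0) u < 0 ->
  exists2 t, 0 < t & Q b (x + t *: u) /\
    exists2 c, ~~ tight b x c & tight b (x + t *: u) c.
Proof.
move=> Qx xu c0u.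
pose q c := (ssum (csupp c) x - (cbound b c)%:R) / - ssum (csupp c) u.
have ntight c : ssum (csupp c) u < 0 -> ~~ tight b x c.
  by move=> cu; apply/negP => /xu cu0; rewrite cu0 ltxx in cu.
have q_gt0 c : ssum (csupp c) u < 0 -> 0 < q c.
  move=> cu; rewrite divr_gt0 ?oppr_gt0 // subr_gt0 lt_neqAle Qx andbT eq_sym.
  exact: ntight.
case: (@arg_minP _ F _ c0 (fun c => ssum (csupp c) u < 0) q c0u) => c cu cmin.
exists (q c); first exact: q_gt0.
split; last first.
  exists c; first exact: ntight.
  by rewrite /tight ssumD ssumZ /q; apply/eqP; field; rewrite lt_eqF.
move=> d; rewrite ssumD ssumZ; have [du|du] := ltP (ssum (csupp d) u) 0.
  move: (cmin d du); rewrite {2}/q ler_pdivlMr ?oppr_gt0 // mulrN; lra.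
by apply: le_trans (Qx d) _; rewrite lerDl mulr_ge0 // ltW ?q_gt0.
Qed.

Lemma tight_step b x u : Q b x -> tight_direction b x u ->
  exists2 t, 0 < t & Q b (x + t *: u).
Proof.
move=> Qx xu.
have [[c cu]|uP] := pselect (exists c, ssum (csupp c) u < 0).
  by have [t t0 [Qt _]] := tight_step_lt0 Qx xu cu; exists t.
exists 1 => // c; rewrite scale1r ssumD; apply: le_trans (Qx c) _.
by rewrite lerDl leNgt; apply/negP => cu; apply: uP; exists c.
Qed.

Lemma between x u s t : 0 < s -> 0 < t ->
  x = (s / (s + t)) *: (x + t *: u) + (1 - s / (s + t)) *: (x - s *: u).
Proof.
move=> s0 t0; apply/rowP => i; rewrite !mxE; field.
by rewrite gt_eqF ?addr_gt0.
Qed.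

Lemma between_lt (s t : F) : 0 < s -> 0 < t -> 0 < s / (s + t) < 1.
Proof.
by move=> s0 t0; rewrite divr_gt0 ?addr_gt0 // ltr_pdivrMr ?addr_gt0 // mul1r ltrDl.
Qed.

(** Plain scalars make sense over any ordered field; the notion is used over [rat] and over the
    reals. *)
Definition convex_closed (H : set 'rV[F]_n) : Prop :=
  forall x y t, H x -> H y -> 0 < t < 1 -> H (t *: x + (1 - t) *: y).

Definition upward_closed (H : set 'rV[F]_n) : Prop :=
  forall x y, H x -> (forall i, 0 <= y 0 i) -> H (x + y).

(* A point that is not a vertex moves along a line fixing its tight constraints.
   Each end of the line either meets a new constraint or, the polyhedron being
   contained in the orthant, points upward. *)
Lemma sub_of_vertices b (H : set 'rV[F]_n) : convex_closed H -> upward_closed H ->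
  (forall x, tight_vertex b x -> H x) -> Q b `<=` H.
Proof.
move=> Hconv Hup Hv x.
(* Induction on the number of constraints that are not tight. *)
have [k] := ubnP #|[set c | ~~ tight b x c]%SET|; elim: k x => // k IH x.
rewrite ltnS => kx Qx.
have IHt t u c : tight_direction b x u -> Q b (x + t *: u) ->
    ~~ tight b x c -> tight b (x + t *: u) c -> H (x + t *: u).
  move=> xu Qt ntc tc; apply: IH => //; apply: leq_trans kx.
  apply/proper_card/properP; split.
    apply/fintype.subsetP => d; rewrite !inE; apply: contraNN => td.
    by rewrite /tight ssumD ssumZ xu // mulr0 addr0.
  by exists c; rewrite !inE // negbK.
have main u i : tight_direction b x u -> u 0 i < 0 -> H x.
  rewrite -ssum1 => xu ui.
  have [t t0 [Qt [c ntc tc]]] := tight_step_lt0 Qx xu ui.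
  have Ht := IHt _ _ _ xu Qt ntc tc.
  have [[j uj]|uN] := pselect (exists j, 0 < u 0 j); last first.
    have -> : x = (x + t *: u) + t *: - u by rewrite scalerN addrK.
    apply: Hup => // j; rewrite !mxE mulr_ge0 ?(ltW t0) // oppr_ge0 leNgt.
    by apply/negP => uj; apply: uN; exists j.
  have xNu := tight_directionN xu.
  have Nuj : ssum (csupp (inl j)) (- u) < 0 by rewrite ssumN ssum1 oppr_lt0.
  have [s s0 [Qs [d ntd td]]] := tight_step_lt0 Qx xNu Nuj.
  have Hs := IHt _ _ _ xNu Qs ntd td; rewrite scalerN in Hs.
  by rewrite (between x u s0 t0); apply: Hconv => //; apply: between_lt.
have [vx|] := pselect (tight_vertex b x); first exact: Hv.
move=> /not_andP[//|/existsNP[u /not_implyP[xu u0]]].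
have /rV0Pn[i ui] : u != 0 by apply/eqP.
have [/main|] := ltP (u 0 i) 0; first exact.
rewrite le_eqVlt eq_sym (negbTE ui) /= => ui0.
by apply: (main (- u) i); [exact: tight_directionN|rewrite mxE oppr_lt0].
Qed.

(** A constraint tight strictly between [x] and [y] is tight at both, so [x - y] is a tight
    direction; conversely, along a tight direction [v] can move both ways. *)
Lemma tight_vertexP b v : tight_vertex b v <->
  Q b v /\ forall x y t, Q b x -> Q b y -> 0 < t < 1 ->
    v = t *: x + (1 - t) *: y -> x = y.
Proof.
split=> -[Qv vP]; split=> //.
  move=> x y t Qx Qy /andP[t0 t1] vE; apply/eqP; rewrite -subr_eq0; apply/eqP/vP => c.
  rewrite /tight vE !(ssumD, ssumZ, ssumN) => /eqP cE.
  have := Qx c; have := Qy c; move: cE.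
  move: (ssum _ x) (ssum _ y) (cbound _ _)%:R => X Y B cE BY BX.
  have : t * (X - B) + (1 - t) * (Y - B) = 0 
    by transitivity (t * X + (1 - t) * Y - B); [ring|rewrite cE subrr].
  move/eqP; rewrite paddr_eq0 ?mulr_ge0 ?subr_ge0 // ?(ltW t0) ?(ltW t1) //.
  rewrite !mulf_eq0 gt_eqF //= subr_eq0 => /andP[/eqP ->].
  by rewrite !subr_eq0 gt_eqF //= => /eqP ->; rewrite subrr.
move=> u vu; have [t t0 Qt] := tight_step Qv vu.
have [s s0 Qs] := tight_step Qv (tight_directionN vu); rewrite scalerN in Qs.
have /eqP := vP _ _ _ Qt Qs (between_lt s0 t0) (between v u s0 t0).
rewrite -subr_eq0; have -> : v + t *: u - (v - s *: u) = (t + s) *: u.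
  by apply/rowP => i; rewrite !mxE; ring.
by rewrite scaler_eq0 gt_eqF ?addr_gt0 //= => /eqP.
Qed.

End Polyhedron.

(** * Rationality of vertices *)

Section Rational.
Variables (F : realFieldType) (n : nat) (b : {set 'I_n} -> nat).
Implicit Types (x u v : 'rV[F]_n).

(** Constraints outside [T] give zero columns. The matrix is rational, so that one rank serves every
    field [F]. *)
Definition tight_mx (T : pred ('I_n + {set 'I_n})) :
    'M[rat]_(n, #|{: 'I_n + {set 'I_n}}|) :=
  \matrix_(i, k) (T (enum_val k) && (i \in csupp (enum_val k)))%:R.

Lemma mul_tight_mx T u k :
  (u *m map_mx ratr (tight_mx T)) 0 k =
  if T (enum_val k) then ssum (csupp (enum_val k)) u else 0.
Proof.
rewrite mxE /ssum; case: ifP => Tk; last first.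
  by rewrite big1 // => i _; rewrite !mxE Tk /= rmorph0 mulr0.
rewrite [RHS]big_mkcond; apply: eq_bigr => i _.
by rewrite !mxE Tk /= rmorph_nat; case: (i \in _); rewrite (mulr1, mulr0).
Qed.

(** The left kernel over [F] consists of the tight directions, and extending the field does not
    change the rank. *)
Lemma tight_mxP v : (forall u, tight_direction b v u -> u = 0) <->
  row_free (tight_mx (tight b v)).
Proof.
rewrite -(row_free_map (ratr : {rmorphism rat -> F})).
split=> [vP|/row_freeP[B AB] u vu].
  apply: inj_row_free => u uM; apply: vP => c tc.
  have := mul_tight_mx (tight b v) u (enum_rank c).
  by rewrite uM mxE enum_rankK tc.
rewrite -[u]mulmx1 -AB mulmxA.
suff -> : u *m map_mx ratr (tight_mx (tight b v)) = 0 by rewrite mul0mx.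
by apply/rowP => k; rewrite mul_tight_mx mxE; case: ifP => // /vu.
Qed.

(** The tight equations at [v] have a rational right-hand side [y] and a matrix with a rational
    right inverse [B], so [v] is [y *m B]. *)
Lemma tight_vertex_rat v : tight_vertex b v ->
  exists w : 'rV[rat]_n, v = map_mx ratr w.
Proof.
move=> [_ /tight_mxP/row_freeP[B MB]].
pose y : 'rV[rat]_#|{: 'I_n + {set 'I_n}}| :=
  \row_k (if tight b v (enum_val k) then (cbound b (enum_val k))%:R else 0).
exists (y *m B); rewrite map_mxM.
have <- : v *m map_mx ratr (tight_mx (tight b v)) = map_mx ratr y.
  apply/rowP => k; rewrite mul_tight_mx !mxE; case: ifP => [/eqP ->|_].
    by rewrite rmorph_nat.
  by rewrite rmorph0.
by rewrite -mulmxA -map_mxM MB map_mx1 mulmx1.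
Qed.

Lemma ssum_ratr S (w : 'rV[rat]_n) : ssum S (map_mx ratr w) = ratr (ssum S w) :> F.
Proof. by rewrite /ssum rmorph_sum; apply: eq_bigr => i _; rewrite mxE. Qed.

Lemma Q_ratr (w : 'rV[rat]_n) : Q b (map_mx ratr w : 'rV[F]_n) <-> Q b w.
Proof.
by split=> Qw c; move: (Qw c); rewrite ssum_ratr -(ratr_nat F) ler_rat.
Qed.

End Rational.

Lemma tight_vertex_ratr (F : realFieldType) n b (w : 'rV[rat]_n) :
  tight_vertex b w -> tight_vertex b (map_mx ratr w : 'rV[F]_n).
Proof.
move=> [Qw wP]; split; first exact/Q_ratr.
apply/tight_mxP; move/tight_mxP: wP; congr (is_true (row_free _)).
apply/matrixP => i k; rewrite !mxE; congr ((_ && _)%:R).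
by rewrite /tight ssum_ratr -(ratr_nat F) (inj_eq (fmorph_inj _)).
Qed.

Lemma Q_scale (F : realFieldType) n (b : {set 'I_n} -> nat) d (x : 'rV[F]_n) :
  (0 < d)%N -> Q (fun S => d * b S)%N (d%:R *: x) <-> Q b x.
Proof.
move=> d0; have E c : (cbound (fun S => d * b S)%N c = d * cbound b c)%N.
  by case: c => //= i; rewrite muln0.
have dF : 0 < d%:R :> F by rewrite ltr0n.
by split=> Qx c; move: (Qx c); rewrite E ssumZ natrM ler_pM2l.
Qed.

Lemma tight_vertex_scale (F : realFieldType) n (b : {set 'I_n} -> nat) d (x : 'rV[F]_n) :
  (0 < d)%N -> tight_vertex (fun S => d * b S)%N (d%:R *: x) <-> tight_vertex b x.
Proof.
move=> d0; have E c : (cbound (fun S => d * b S)%N c = d * cbound b c)%N.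
  by case: c => //= i; rewrite muln0.
have dF : d%:R != 0 :> F by rewrite pnatr_eq0 -lt0n.
have tE c : tight (fun S => d * b S)%N (d%:R *: x) c = tight b x c.
  by rewrite /tight E ssumZ natrM (inj_eq (mulfI dF)).
split=> -[Qx xP]; (split; first by move: Qx; rewrite Q_scale).
  by move=> u xu; apply: xP => c; rewrite tE; apply: xu.
by move=> u xu; apply: xP => c tc; apply: xu; rewrite tE.
Qed.

(** * Newton and symbolic polyhedra *)

Section Hull.
Variables (R : realType) (n : nat).
Implicit Types (A X : set 'rV[R]_n) (x y : 'rV[R]_n).

Lemma convex_setP A : @convex_set R 'rV[R]_n A <-> convex_closed A.
Proof.
rewrite convex_setW; split=> [cA x y t Ax Ay /andP[t0 t1]|cA x y].
  have := cA x y (mem_set Ax) (mem_set Ay) (Itv01 (ltW t0) (ltW t1)) t0 t1.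
  by rewrite inE.
by rewrite !inE => Ax Ay k k0 k1; apply/mem_set/(cA x y k%:num Ax Ay); rewrite k0 k1.
Qed.

Lemma sub_hull A : A `<=` convex_hull A.
Proof. by move=> x Ax X [_]; apply. Qed.

Lemma hull_convex A : convex_closed (convex_hull A).
Proof.
move=> x y t Ax Ay t01 X XP; have [/convex_setP cX _] := XP.
by apply: cX t01; [apply: Ax|apply: Ay].
Qed.

Lemma hull_min A X : convex_closed X -> A `<=` X -> convex_hull A `<=` X.
Proof. by move=> cX AX x; apply; split=> //; apply/convex_setP. Qed.

(* Removing an extreme point from a convex set leaves it convex. *)
Lemma extreme_point_hull A x :
  vertices (convex_hull A) x -> A x.
Proof.
move=> [Ax ext]; apply: contrapT => nAx.
suff /(_ _ Ax) [_ /(_ erefl)] :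
    convex_hull A `<=` [set y | convex_hull A y /\ y <> x] by [].
apply: hull_min => [y z t [Ay yx] [Az zx] t01|y Ay]; last first.
  by split; [exact: sub_hull|move=> yx; apply: nAx; rewrite -yx].
split; first exact: hull_convex.
move=> /esym xE; have yz := ext _ _ _ Ay Az t01 xE.
by apply: yx; rewrite xE yz -scalerDl addrC subrK scale1r.
Qed.

Lemma Q_convex b : convex_closed (Q b : set 'rV[R]_n).
Proof.
move=> x y t Qx Qy /andP[t0 t1] c; rewrite ssumD !ssumZ.
have := Qx c; have := Qy c; move: (ssum _ _) (ssum _ _) (_ %:R) => X Y B; nra.
Qed.

End Hull.

Section Newton.
Variables (R : realType) (K : fieldType) (n : nat).
Implicit Types (S T : {set 'I_n}) (m : 'X_{1..n}) (b : {set 'I_n} -> nat).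

Lemma ssum_exponent_point S m : ssum S (exponent_point R m) = (sdeg S m)%:R.
Proof. by rewrite /ssum /sdeg natr_sum; apply: eq_bigr => i _; rewrite mxE. Qed.

Lemma ssum_delta S i : ssum S (delta_mx 0 i : 'rV[R]_n) = (i \in S)%:R.
Proof.
have -> : delta_mx 0 i = exponent_point R U_(i)%MM.
  by apply/rowP => j; rewrite !mxE mnm1E eqxx eq_sym.
by rewrite ssum_exponent_point sdeg1.
Qed.

Lemma Q_exponent_point b m : Q b (exponent_point R m) <-> Ib b ('X_[m] : {mpoly K[n]}).
Proof.
rewrite QP IbX; split=> [[_ mS] S|mS].
  by move: (mS S); rewrite ssum_exponent_point ler_nat.
by split=> [i|S]; [rewrite mxE ler0n|rewrite ssum_exponent_point ler_nat].
Qed.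

Lemma newton_polyhedron_sub b :
  newton_polyhedron R (Ib b : set {mpoly K[n]}) `<=` Q b.
Proof.
apply: hull_min; first exact: Q_convex.
by move=> _ [m /= Im <-]; apply/Q_exponent_point.
Qed.

(** The points from which a coordinate ray stays in the hull form a convex set, so it suffices to
    start at exponents; a general vector is a sum of coordinate steps. *)
Lemma newton_polyhedron_upward (I : set {mpoly K[n]}) :
  is_ideal I -> upward_closed (newton_polyhedron R I).
Proof.
move=> iI; set N := newton_polyhedron R I.
have cN : convex_closed N by apply: hull_convex.
have Ni i : N `<=` [set x | forall s, 0 <= s -> N (x + s *: delta_mx 0 i)].
  apply: hull_min => [x y t Nx Ny t01 s s0|_ [m Im <-] s s0].
    have -> : t *: x + (1 - t) *: y + s *: delta_mx 0 i =
        t *: (x + s *: delta_mx 0 i) + (1 - t) *: (y + s *: delta_mx 0 i).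
      by apply/rowP => j; rewrite !mxE; ring.
    by apply: cN t01; [apply: Nx|apply: Ny].
  have [->|sn0] := eqVneq s 0.
    by rewrite scale0r addr0; apply: sub_hull; exists m.
  have {sn0} s_gt0 : 0 < s by rewrite lt_neqAle eq_sym sn0.
  have := archi_boundP s0; set M := Num.bound s => sM.
  have M0 : 0 < M%:R :> R by apply: lt_trans sM.
  (* The point lies between [m] and the exponent with an integer [M > s] added to its [i]-th
     entry. *)
  have -> : exponent_point R m + s *: delta_mx 0 i =
     (s / M%:R) *: exponent_point R (m + U_(i) *+ M)%MM
       + (1 - s / M%:R) *: exponent_point R m.
    apply/rowP => j; rewrite !mxE mnmDE mulmnE mnm1E eqxx /= natrD natrM eq_sym.
    by field; rewrite gt_eqF.
  apply: cN; [| |by rewrite divr_gt0 //= ltr_pdivrMr // mul1r].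
    apply: sub_hull; exists (m + U_(i) *+ M)%MM => //=.
    by rewrite mpolyXD; apply: (ideal_memMr _ iI).
  by apply: sub_hull; exists m.
move=> x y Nx y0; rewrite [y]row_sum_delta.
elim/big_ind: _ x Nx => [x|u v IHu IHv x Nx|i _ x Nx].
- by rewrite addr0.
- by rewrite addrA; apply: IHv; apply: IHu.
- by apply: Ni (y0 i).
Qed.

(** The hull is convex and upward closed, and integrality makes the vertices exponents of monomials
    of [Ib b]. *)
Lemma newton_polyhedron_Ib b :
  (forall v : 'rV[R]_n, tight_vertex b v -> exists m, v = exponent_point R m) ->
  newton_polyhedron R (Ib b : set {mpoly K[n]}) = Q b.
Proof.
move=> bV; apply/seteqP; split; first exact: newton_polyhedron_sub.
apply: sub_of_vertices; first exact: hull_convex.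
  by apply: newton_polyhedron_upward; apply: Ib_ideal.
move=> v vV; have [m vE] := bV v vV; rewrite vE in vV *.
by apply: sub_hull; exists m => //=; apply/Q_exponent_point; case: vV.
Qed.

Definition single S e T := if T == S then e else 0%N.

Lemma Ib_single S e : Ib (single S e) = Fil S e :> set {mpoly K[n]}.
Proof.
apply/seteqP; split=> f; first by move=> /(_ S); rewrite /single eqxx.
by move=> Ff T; rewrite /single; case: eqP => [->//|_]; rewrite Fil0.
Qed.

(** A vertex is the origin or [e] times the unit vector of some [i] in [S]. *)
Lemma tight_vertex_single S e (v : 'rV[R]_n) :
  tight_vertex (single S e) v -> exists m, v = exponent_point R m.
Proof.
move=> [Qv vP]; have v0 := Q_ge0 Qv.
(* Constraints other than that of [S] have bound 0; when tight, they make the coordinates in their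
   support vanish. *)
have tight0 i c : v 0 i != 0 -> c <> inr S -> tight (single S e) v c -> i \notin csupp c.
  move=> vi cS; rewrite /tight; have -> : cbound (single S e) c = 0%N.
    by case: c cS => //= T TS; rewrite /single; case: eqP => // E; rewrite E in TS.
  rewrite psumr_eq0 // => /allP vc; apply: contraNN vi => ic.
  by have := vc i; rewrite mem_index_enum ic /=; apply.
have delta0 i : (delta_mx 0 i : 'rV[R]_n) <> 0.
  by move=> /rowP /(_ i); rewrite !mxE !eqxx => /eqP; rewrite oner_eq0.
have vS i : v 0 i != 0 -> i \in S /\ tight (single S e) v (inr S).
  move=> vi; suff : ~ (tight (single S e) v (inr S) -> i \notin S).
    by move/not_implyP => [? /negP]; rewrite negbK.
  move=> tS; apply: (delta0 i); apply: vP => c tc; rewrite ssum_delta.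
  have [cS|cS] := pselect (c = inr S).
    by rewrite cS in tc *; rewrite (negbTE (tS tc)).
  by rewrite (negbTE (tight0 _ _ vi cS tc)).
(* Two nonzero coordinates would make the difference of their unit vectors a tight direction. *)
have vU i j : v 0 i != 0 -> v 0 j != 0 -> i = j.
  move=> vi vj; apply: contrapT => ij.
  have : (delta_mx 0 i - delta_mx 0 j : 'rV[R]_n) = 0.
    apply: vP => c tc; rewrite ssumD ssumN !ssum_delta.
    have [cS|cS] := pselect (c = inr S).
      by rewrite cS /= (vS i vi).1 (vS j vj).1 subrr.
    by rewrite !(negbTE (tight0 _ _ _ cS tc)) // subrr.
  move=> /rowP /(_ i); rewrite !mxE !eqxx (introF eqP ij) subr0 => /eqP.
  by rewrite oner_eq0.
have [[i vi]|vN] := pselect (exists i, v 0 i != 0); last first.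
  exists 0%MM; apply/rowP => i; rewrite mxE mnm0E; apply/eqP.
  by apply: contraPT vN => vi; rewrite notE; exists i.
have vj j : j != i -> v 0 j = 0.
  by apply: contraNeq => vj; rewrite (vU _ _ vj vi).
exists (U_(i) *+ e)%MM; apply/rowP => j; rewrite mxE mulmnE mnm1E.
have [<-|ji] := eqVneq i j; last by rewrite vj // eq_sym.
have [iS] := vS i vi; rewrite /tight /= /ssum /single eqxx (bigD1 i) //= big1.
  by rewrite addr0 mul1n => /eqP.
by move=> k /andP[_ /vj].
Qed.

(** Localization isolates one component, whose polyhedron is cut from the orthant by one inequality;
    without components, only the orthant remains. *)
Lemma symbolic_polyhedron_Ib b : exponents b ->
  symbolic_polyhedron R (Ib b : set {mpoly K[n]}) = Q b.
Proof.
move=> hb; rewrite /symbolic_polyhedron max_ass_primes_Ib //.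
have NE S : newton_polyhedron R (Fil S (b S) : set {mpoly K[n]}) = Q (single S (b S)).
  by rewrite -Ib_single newton_polyhedron_Ib //; apply: tight_vertex_single.
apply/seteqP; split=> x.
  move=> [x0 xS]; apply/QP; split=> // S.
  have [->|bS] := posnP (b S); first by apply: sumr_ge0.
  have := xS (Fil S 1); rewrite /= loc_contraction_Ib // NE.
  move=> /(_ (ex_intro2 _ _ S bS erefl)).
  by move/QP => [_ /(_ S)]; rewrite /single eqxx.
move=> /QP[x0 xS]; split=> // _ [S bS ->]; rewrite loc_contraction_Ib // NE.
by apply/QP; split=> // T; rewrite /single; case: eqP => [->//|_]; apply: sumr_ge0.
Qed.

End Newton.

(** * Integral closure *)

(** If [f] had order [d < e], integral dependence would equate [f ^+ m], of order [d * m], with a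
    sum of terms of larger order. *)
Lemma Fil_integrally_closed (K : fieldType) n (S : {set 'I_n}) e (J : set {mpoly K[n]}) :
  J `<=` Fil S e -> integral_closure J `<=` Fil S e.
Proof.
move=> JF f [m [a [m_gt0 Ja fE]]]; apply: contrapT => /Fil_order[d de [Ff nFf]].
have FX k : Fil S (d * k) (f ^+ k).
  elim: k => [|k IH]; first by rewrite muln0 Fil0.
  by rewrite exprS mulnS; apply: FilM.
have nFX k : ~ Fil S (d * k).+1 (f ^+ k).
  elim: k => [|k IH]; first by rewrite muln0; case: (@Fil_prime K n S).
  by rewrite exprS mulnS; apply: Fil_valuation.
have iF := @Fil_ideal K n S (d * m).+1.
apply: (nFX m).
rewrite -(addrK (\sum_(1 <= i < m.+1) a i * f ^+ (m - i)) (f ^+ m)) fE add0r.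
apply: (ideal_memN iF); rewrite big_nat_cond; apply: (ideal_mem_sum _ iF) => i.
rewrite andbT ltnS => im; have /andP[i_gt0 i_le] := im.
have Fa : Fil S (e * i) (a i).
  move: (Ja i im); apply: ideal_pow_filtration => //.
  - exact: Fil_ideal.
  - by move=> *; apply: FilM.
  - exact: Fil0.
apply: sub_Fil (FilM Fa (FX (m - i)%N)).
have <- : (d * i + d * (m - i) = d * m)%N by rewrite -mulnDr subnKC.
by rewrite -addSn leq_add2r ltn_pmul2r.
Qed.

Section DeterminantTrick.
Variables (A : comNzRingType) (J : set A).
Implicit Types (q r : {poly A}).

(** Weight at least [w], where ['X] has weight 1 and the [k]-th power of [J] weight [k]; truncated
    subtraction leaves the coefficients from degree [w] on free. *)
Definition Rees w : set {poly A} := [set q | forall i, ideal_pow J (w - i) q`_i].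

Lemma ReesD w q r : Rees w q -> Rees w r -> Rees w (q + r).
Proof.
by move=> Rq Rr i; rewrite coefD; apply: (ideal_memD (ideal_pow_ideal _ _)).
Qed.

Lemma ReesN w q : Rees w q -> Rees w (- q).
Proof.
by move=> Rq i; rewrite coefN; apply: (ideal_memN (ideal_pow_ideal _ _)).
Qed.

Lemma Rees0 w : Rees w 0.
Proof. by move=> i; rewrite coef0; apply: (ideal_mem0 (ideal_pow_ideal _ _)). Qed.

Lemma ReesM w w' q r : Rees w q -> Rees w' r -> Rees (w + w') (q * r).
Proof.
move=> Rq Rr i; rewrite coefM; apply: (ideal_mem_sum _ (ideal_pow_ideal _ _)) => j _.
by apply: sub_ideal_pow (mem_ideal_powD (Rq j) (Rr (i - j)%N)); have := ltn_ord j; lia.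
Qed.

Lemma ReesC w a : ideal_pow J w a -> Rees w a%:P.
Proof.
move=> Ja i; rewrite coefC; case: eqP => [->|_]; first by rewrite subn0.
exact: (ideal_mem0 (ideal_pow_ideal _ _)).
Qed.

Lemma ReesX : Rees 1 'X.
Proof.
move=> i; rewrite coefX; case: eqP => [->//|_].
exact: (ideal_mem0 (ideal_pow_ideal _ _)).
Qed.

(* Grading by [wt] makes the characteristic polynomial homogeneous of weight [p]:
   along a permutation the weights [1 + wt i - wt j] of the entries telescope. *)
Lemma Rees_char_poly p (wt : 'I_p -> nat) (C : 'M[A]_p) :
  (forall i j, C i j = 0 \/
    (wt j <= (wt i).+1)%N /\ ideal_pow J ((wt i).+1 - wt j) (C i j)) ->
  Rees p (char_poly C).
Proof.
move=> CJ.
have MJ i j : char_poly_mx C i j = 0 \/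
    (wt j <= (wt i).+1)%N /\ Rees ((wt i).+1 - wt j) (char_poly_mx C i j).
  rewrite !mxE; have [ij|ij] := eqVneq i j; last first.
    rewrite mulr0n sub0r; have [->|[wij Cij]] := CJ i j; first by left; rewrite oppr0.
    by right; split=> //; apply/ReesN/ReesC.
  right; rewrite -ij subSn // subnn mulr1n; split=> //.
  apply: ReesD ReesX _; apply/ReesN/ReesC.
  have [->|[_]] := CJ i i; first exact: (ideal_mem0 (ideal_pow_ideal _ _)).
  by rewrite subSn // subnn.
suff Rp (s : 'S_p) : Rees p (\prod_i char_poly_mx C i (s i)).
  rewrite /char_poly /determinant.
  elim/big_ind: _ => [|q r|s _]; [exact: Rees0|exact: ReesD|].
  by rewrite -signr_odd; case: (odd _); rewrite ?mulN1r ?mul1r //; apply: ReesN.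
have [[i Mi]|nz] := pselect (exists i, char_poly_mx C i (s i) = 0).
  by rewrite (bigD1 i) //= Mi mul0r; apply: Rees0.
have {}MJ i : (wt (s i) <= (wt i).+1)%N /\
    Rees ((wt i).+1 - wt (s i)) (char_poly_mx C i (s i)).
  by have [Mi|//] := MJ i (s i); case: nz; exists i.
have wtE : p = (\sum_i ((wt i).+1 - wt (s i)))%N.
  rewrite sumnB => [|i _]; last by case: (MJ i).
  have <- : (\sum_i wt i = \sum_i wt (s i))%N by rewrite [LHS](reindex_perm s).
  under [X in (X - _)%N]eq_bigr do rewrite -add1n.
  by rewrite big_split /= sum1_card card_ord addnK.
rewrite [X in Rees X]wtE.
elim/big_ind2: _ => [|w1 q1 w2 q2|i _]; [|exact: ReesM|by case: (MJ i)].
by rewrite -polyC1; apply: ReesC.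
Qed.

(** The adjugate turns [(f%:M - C) *m v = 0] into the vanishing of the characteristic polynomial at
    [f], as an entry of [v] is 1; the weights put its coefficients in the required powers of [J]. *)
Lemma integral_closure_mx p (wt : 'I_p -> nat) (C : 'M[A]_p) (v : 'cV[A]_p) k f :
  (forall i j, C i j = 0 \/
    (wt j <= (wt i).+1)%N /\ ideal_pow J ((wt i).+1 - wt j) (C i j)) ->
  f *: v = C *m v -> v k 0 = 1 -> integral_closure J f.
Proof.
move=> /Rees_char_poly RC fv vk.
exists p, (fun i => (char_poly C)`_(p - i)); split.
- by case: p k {C v wt RC fv vk} => [[]|].
- by move=> i /andP[_ ip]; have := RC (p - i)%N; rewrite subKn.
have det0 : (char_poly C).[f] = 0.
  have -> : (char_poly C).[f] = \det (f%:M - C).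
    rewrite -horner_evalE /char_poly -det_map_mx; congr (\det _).
    by apply/matrixP => i j; rewrite !mxE /= ?horner_evalE !(hornerE, hornerMn).
  have /(congr1 (fun u => (\adj (f%:M - C) *m u) k 0)) : (f%:M - C) *m v = 0.
    by rewrite mulmxBl mul_scalar_mx fv subrr.
  by rewrite mulmxA mul_adj_mx mul_scalar_mx mulmx0 !mxE vk mulr1.
rewrite -[RHS]det0 horner_coef size_char_poly big_ord_recr /=.
have -> : (char_poly C)`_p = 1.
  by have /monicP := char_poly_monic C; rewrite lead_coefE size_char_poly.
rewrite mul1r addrC; congr (_ + _).
rewrite -(big_mkord xpredT (fun i => (char_poly C)`_i * f ^+ i)).
by rewrite big_add1 [RHS]big_nat_rev.
Qed.

Lemma integral_closure_lincomb p (c g : 'I_p -> A) N :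
  (0 < N)%N -> (forall j, ideal_pow J N (g j ^+ N)) ->
  integral_closure J (\sum_j c j * g j).
Proof.
case: N => // N _ gJ.
(* The monomials in the [g j] with exponents at most [N] span a module stable
   under multiplication by the [g j]; they are weighted by total degree. *)
pose T := {ffun 'I_p -> 'I_N.+1}.
pose wt (a : T) := (\sum_j a j)%N.
pose v (a : T) := \prod_j g j ^+ a j.
(* Multiplication by [g j] raises its exponent cyclically; wrapping from [N] to 0 splits off the
   factor [kappa a j], which lies in the power [N.+1] of [J]. *)
pose next (a : T) j : T := [ffun l => if l == j then ordS (a j) else a l].
pose kappa (a : T) j := if a j == N :> nat then g j ^+ N.+1 else 1.
have nextE (a : T) j : (wt (next a j) + a j = wt a + ordS (a j))%N.
  rewrite /wt (bigD1 j) //= [in RHS](bigD1 j) //= ffunE eqxx.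
  rewrite (eq_bigr (fun l => a l : nat)) => [|l /negbTE lj].
    by rewrite /=; lia.
  by rewrite ffunE lj.
have ordSE (a : T) j : ordS (a j) = (if a j == N :> nat then 0 else (a j).+1)%N :> nat.
  rewrite /=; case: eqP => [->|aN]; first by rewrite modnn.
  by rewrite modn_small // ltnS; have := ltn_ord (a j); lia.
have gv a j : g j * v a = kappa a j * v (next a j).
  rewrite /v (bigD1 j) //= [in RHS](bigD1 j) //= ffunE eqxx ordSE /kappa.
  rewrite [X in _ = _ * (_ * X)](eq_bigr (fun l => g l ^+ a l)) => [|l /negbTE lj].
    case: eqP => [->|_]; first by rewrite expr0 mul1r mulrA -exprS.
    by rewrite mul1r mulrA -exprS.
  by rewrite ffunE lj.
(* [C] is the matrix of multiplication by the linear combination on these monomials. *)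
pose C := \matrix_(k < #|{: T}|, l < #|{: T}|)
  \sum_(j | next (enum_val k) j == enum_val l) c j * kappa (enum_val k) j.
apply: (@integral_closure_mx _ (fun k => wt (enum_val k)) C
  (\col_k v (enum_val k)) (enum_rank [ffun=> ord0])).
- move=> k l; rewrite mxE; move: (enum_val k) (enum_val l) => a b.
  have [[j /eqP ab]|nab] := pselect (exists j, next a j == b); last first.
    by left; rewrite big1 // => j ab; case: nab; exists j.
  right; have step i : next a i = b -> (wt b <= (wt a).+1)%N /\
      ideal_pow J ((wt a).+1 - wt b) (kappa a i).
    move=> <-; have := nextE a i; rewrite ordSE /kappa; case: eqP => [->|_] E.
      have -> : ((wt a).+1 - wt (next a i) = N.+1)%N by lia.
      by split=> //; lia.
    have -> : (wt (next a i) = (wt a).+1)%N by lia.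
    by rewrite subnn.
  split; first by case: (step j ab).
  apply: (ideal_mem_sum _ (ideal_pow_ideal _ _)) => i /eqP /step[_].
  exact: (ideal_memMl _ (ideal_pow_ideal _ _)).
- apply/colP => k; rewrite !mxE; set a := enum_val k.
  under [RHS]eq_bigr do rewrite !mxE.
  rewrite (reindex_onto enum_rank enum_val) => [|l _]; last exact: enum_valK.
  rewrite /= mulr_suml (partition_big (next a) xpredT) //=.
  rewrite [RHS](eq_bigl xpredT) => [|b]; last by rewrite enum_rankK eqxx.
  apply: eq_bigr => b _; rewrite enum_rankK mulr_suml.
  by apply: eq_bigr => j /eqP ab; rewrite -mulrA gv -/a ab mulrA.
by rewrite mxE enum_rankK /v big1 // => j _; rewrite ffunE expr0.
Qed.

End DeterminantTrick.

(** * Denominators *)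

Lemma denominator_ratr (R : realType) (q : rat) : denominator (ratr q : R) = `|denq q|%N.
Proof.
rewrite /denominator; case: xgetP => [d _ [q' /= /fmorph_inj -> <-//]|].
by move=> /(_ `|denq q|%N) []; exists q.
Qed.

Lemma denq_dvd (q : rat) (d m : nat) : d%:R * q = m%:R -> (`|denq q| %| d)%N.
Proof.
move=> qE; have : numq q * d%:Z = m%:Z * denq q.
  apply/eqP; rewrite -(eqr_int rat) !intrM -[m%:~R]/(m%:R) -qE -[d%:~R]/(d%:R).
  by rewrite numqE mulrC mulrA.
move=> E; have : (denq q %| numq q * d%:Z)%Z by rewrite E dvdz_mull.
rewrite Gauss_dvdzr // /coprimez gcdzC.
by have := coprime_num_den q; rewrite /coprime /gcdz => /eqP ->.
Qed.

Lemma denq_dvd_nat (q : rat) (d : nat) : 0 <= q -> (`|denq q| %| d)%N ->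
  exists m : nat, d%:R * q = m%:R.
Proof.
move=> q0 /dvdnP[e ->]; exists (e * `|numq q|)%N.
rewrite !natrM -mulrA; congr (_ * _).
rewrite !natr_absz ger0_norm ?denq_ge0 // ger0_norm ?numq_ge0 //.
by rewrite numqE mulrC.
Qed.

Lemma rat_frac_nat (q : rat) : 0 <= q ->
  exists2 d : nat, (0 < d)%N & exists m : nat, d%:R * q = m%:R.
Proof.
move=> q0; exists `|denq q|%N; first by rewrite absz_gt0 denq_neq0.
exact: denq_dvd_nat.
Qed.

(** * Integral closures of powers when the vertices are lattice points *)

Section Veronese.
Variables (R : realType) (K : fieldType) (n : nat) (b : {set 'I_n} -> nat).
Hypothesis bV : forall v : 'rV[R]_n, tight_vertex b v -> exists m, v = exponent_point R m.
Local Notation J := (Ib b : set {mpoly K[n]}).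

(** Points visible in a high power of [J]; they are taken over [rat] so that denominators can be
    cleared. *)
Definition asymptotic : set 'rV[rat]_n :=
  [set x | exists2 N : nat, (0 < N)%N & exists2 m : 'X_{1..n},
    forall i, N%:R * x 0 i = (m i)%:R & ideal_pow J N 'X_[m]].

(** The larger set is convex and upward closed, and it contains the vertices with [N = 1]. *)
Lemma Q_asymptotic : Q b `<=` asymptotic.
Proof.
apply: sub_of_vertices.
- move=> x y t [N1 N1_gt0 [m1 m1E Jm1]] [N2 N2_gt0 [m2 m2E Jm2]] /andP[t0 t1].
  have [d d_gt0 [p tE]] := rat_frac_nat (ltW t0).
  have pd : (p <= d)%N.
    by rewrite -(ler_nat rat) -tE ler_piMr ?ler0n // ltW.
  (* Here [t = p / d], and [d * N1 * N2] clears the denominators of [t], [x] and [y] together. *)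
  exists (d * N1 * N2)%N; first by rewrite !muln_gt0 d_gt0 N1_gt0.
  exists (m1 *+ (N2 * p) + m2 *+ (N1 * (d - p)))%MM => [i|].
    rewrite !mxE mnmDE !mulmnE !(natrD, natrM) natrB // -m1E -m2E -tE; ring.
  rewrite mpolyXD -!mpolyXn.
  have -> : (d * N1 * N2 = N1 * (N2 * p) + N2 * (N1 * (d - p)))%N.
    by rewrite -{1}(subnKC pd); lia.
  by apply: mem_ideal_powD; apply: mem_ideal_powX.
- move=> x y [N N_gt0 [m mE Jm]] y0.
  have [d d_gt0 [u uE]] : exists2 d : nat, (0 < d)%N &
      exists u : 'I_n -> nat, forall i, d%:R * y 0 i = (u i)%:R.
    exists (\prod_i `|denq (y ord0 i)|)%N.
      by apply: prodn_gt0 => i; rewrite absz_gt0 denq_neq0.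
    suff : forall i, exists m : nat, (\prod_i `|denq (y ord0 i)|)%N%:R * y 0 i = m%:R.
      by move=> /choice[u uE]; exists u.
    move=> i; apply: denq_dvd_nat => //.
    by rewrite (bigD1 i) //= dvdn_mulr.
  exists (N * d)%N; first by rewrite muln_gt0 N_gt0.
  exists (m *+ d + [multinom (N * u i)%N | i < n])%MM => [i|].
    by rewrite mxE mnmDE mulmnE mnmE natrD !natrM -mE -uE; ring.
  rewrite mpolyXD -mpolyXn; apply: (ideal_memMr _ (ideal_pow_ideal _ _)).
  exact: mem_ideal_powX.
move=> x vx; have [m mE] := bV (tight_vertex_ratr R vx).
exists 1%N => //; exists m => [i|].
  apply: (fmorph_inj (ratr : {rmorphism rat -> R})).
  by move/rowP: mE => /(_ i); rewrite !mxE mul1r /= => ->; rewrite ratr_nat.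
rewrite ideal_pow1; last exact: Ib_ideal.
by apply/(Q_exponent_point R); rewrite -mE; apply/Q_ratr; case: vx.
Qed.

(** The point [m / k] of [Q b] has a multiple by some [N] that is the exponent [m'] of a monomial in
    the [N]-th power of [J]; then [N * m = k * m']. *)
Lemma monomial_power_mem k m : (0 < k)%N ->
    Ib (fun S => k * b S)%N ('X_[m] : {mpoly K[n]}) ->
  exists2 N, (0 < N)%N & ideal_pow (ideal_pow J k) N ('X_[m] ^+ N).
Proof.
move=> k_gt0 /(Q_exponent_point R) Qm.
have kR : k%:R != 0 :> R by rewrite pnatr_eq0 -lt0n.
have kQ : k%:R != 0 :> rat by rewrite pnatr_eq0 -lt0n.
pose x : 'rV[rat]_n := \row_i ((m i)%:R / k%:R).
have /Q_asymptotic[N N_gt0 [m' m'E Jm']] : Q b x.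
  apply/(Q_ratr R); apply/(Q_scale _ _ k_gt0).
  suff -> : k%:R *: map_mx ratr x = exponent_point R m by [].
  by apply/rowP => i; rewrite !mxE fmorph_div /= !ratr_nat mulrC divfK.
exists N => //; rewrite ideal_pow_pow mpolyXn.
have -> : (m *+ N = m' *+ k)%MM.
  apply/mnmP => i; rewrite !mulmnE; apply/eqP; rewrite -(eqr_nat rat) !natrM -m'E mxE.
  by apply/eqP; field.
by rewrite -mpolyXn mulnC; apply: mem_ideal_powX.
Qed.

Lemma common_power (s : seq 'X_{1..n}) (L : set {mpoly K[n]}) :
  (forall m, m \in s -> exists2 N, (0 < N)%N & ideal_pow L N ('X_[m] ^+ N)) ->
  exists2 N, (0 < N)%N & forall m, m \in s -> ideal_pow L N ('X_[m] ^+ N).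
Proof.
elim: s => [|m s IH] sL; first by exists 1%N.
have [|N N_gt0 NL] := IH; first by move=> m' m's; apply: sL; rewrite inE m's orbT.
have [N' N'_gt0 N'L] := sL m (mem_head _ _).
exists (N * N')%N; first by rewrite muln_gt0 N_gt0.
move=> m'; rewrite inE => /orP[/eqP ->|/NL m'L].
  by rewrite mulnC exprM; apply: mem_ideal_powX.
by rewrite exprM; apply: mem_ideal_powX.
Qed.

Lemma integral_closure_Ib k : (0 < k)%N ->
  integral_closure (ideal_pow J k) = Ib (fun S => k * b S)%N.
Proof.
move=> k_gt0; apply/seteqP; split=> f.
  move=> fJ S; apply: Fil_integrally_closed fJ => g /ideal_pow_Ib; exact.
move=> If; have [|N N_gt0 NJ] := @common_power (msupp f) (ideal_pow J k).
  by move=> m mf; apply: monomial_power_mem => //; apply/IbX => S; apply: If.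
rewrite [f]mpolyE big_tnth; under eq_bigr do rewrite -mul_mpolyC.
apply: (integral_closure_lincomb _ N_gt0) => j.
exact/NJ/mem_tnth.
Qed.

End Veronese.

(** * Dilations and common denominators of the vertices *)

Lemma dilate_Q (R : realType) n (b : {set 'I_n} -> nat) d : (0 < d)%N ->
  dilate d (Q b : set 'rV[R]_n) = Q (fun S => d * b S)%N.
Proof.
move=> d_gt0; apply/seteqP; split=> [_ [x Qx <-]|x Qx]; first exact/Q_scale.
have d0 : d%:R != 0 :> R by rewrite pnatr_eq0 -lt0n.
exists (d%:R^-1 *: x); last by rewrite scalerA divff // scale1r.
by apply/(Q_scale _ _ d_gt0); rewrite scalerA divff // scale1r.
Qed.

Lemma lcm_denominators_dvd (R : realType) n r (v : 'I_r -> 'rV[R]_n) (d : nat) :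
  (lcm_denominators v %| d)%N <-> forall j i, (denominator (v j ord0 i) %| d)%N.
Proof.
split=> [vd j i|vd].
  have /dvdn_biglcmP/(_ j isT)/dvdn_biglcmP := vd; exact.
by apply/dvdn_biglcmP => j _; apply/dvdn_biglcmP => i _.
Qed.

Lemma lcm_denominators_gt0 (R : realType) n r (v : 'I_r -> 'rV[R]_n) :
  (forall j, exists w : 'rV[rat]_n, v j = map_mx ratr w) -> (0 < lcm_denominators v)%N.
Proof.
move=> vrat; rewrite /lcm_denominators.
elim/big_ind: _ => // [x y x0 y0|j _]; first by rewrite lcmn_gt0 x0.
elim/big_ind: _ => // [x y x0 y0|i _]; first by rewrite lcmn_gt0 x0.
by have [w ->] := vrat j; rewrite mxE denominator_ratr absz_gt0 denq_neq0.
Qed.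

Theorem theorem5p4 (R : realType) (K : fieldType) (n : nat)
    (I : set {mpoly K[n]}) (hI : linear_power_type I)
    (r : nat) (v : 'I_r -> 'rV[R]_n)
    (hv : vertices (symbolic_polyhedron R I) = range v)
    (c : nat) (hc : c = lcm_denominators v) :
  (newton_polyhedron R (symbolic_pow I c) = dilate c (symbolic_polyhedron R I)
   /\ forall k : nat, (0 < k)%N ->
        symbolic_pow I (k * c)%N
        = integral_closure (ideal_pow (symbolic_pow I c) k))
  /\
  ((0 < c)%N /\
   forall d : nat, (0 < d)%N ->
     newton_polyhedron R (symbolic_pow I d)
     = dilate d (symbolic_polyhedron R I) ->
     (c <= d)%N /\ (c %| d)%N).
Proof.
have [b hb IE] := linear_power_type_Ib hI.
have SP : symbolic_polyhedron R I = Q b by rewrite IE symbolic_polyhedron_Ib.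
have sym k : symbolic_pow I k = Ib (fun S => k * b S)%N by rewrite IE symbolic_pow_Ib.
have vP u : tight_vertex b u <-> exists j, u = v j.
  have -> : (exists j, u = v j) = vertices (symbolic_polyhedron R I) u.
    by rewrite hv; apply/propext; split=> [[j ->]|[j _ <-]]; exists j.
  by rewrite SP; exact: tight_vertexP.
have vrat j : exists w : 'rV[rat]_n, v j = map_mx ratr w.
  by apply: (@tight_vertex_rat R n b); apply/vP; exists j.
(* Rationality matters here: an irrational coordinate would have denominator 0. *)
have c_gt0 : (0 < c)%N by rewrite hc; apply: lcm_denominators_gt0.
(* The vertices of the dilate are the points [c%:R *: v j], whose denominators [c] clears. *)
have cV (u : 'rV[R]_n) : tight_vertex (fun S => c * b S)%N u ->
    exists m, u = exponent_point R m.
  have c0 : c%:R != 0 :> R by rewrite pnatr_eq0 -lt0n.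
  have {1 2}-> : u = c%:R *: (c%:R^-1 *: u) by rewrite scalerA divff // scale1r.
  move=> /(tight_vertex_scale _ _ c_gt0) vu; have [j uj] := (vP _).1 vu.
  have [w vw] := vrat j.
  have /choice[m mE] : forall i, exists m : nat, c%:R * w 0 i = m%:R.
    move=> i; apply: denq_dvd_nat.
      have := Q_ge0 vu.1 i; by rewrite uj vw mxE ler0q.
    have /lcm_denominators_dvd/(_ j i) : (lcm_denominators v %| c)%N by rewrite hc.
    by rewrite vw mxE denominator_ratr.
  exists [multinom m i | i < n]; rewrite uj vw; apply/rowP => i.
  by rewrite !mxE mnmE -(ratr_nat R (m i)) -mE rmorphM /= ratr_nat.
rewrite SP; split; split=> //.
- by rewrite sym dilate_Q //; apply: newton_polyhedron_Ib.
- move=> k k_gt0; rewrite !sym (integral_closure_Ib K cV) //.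
  by congr Ib; apply/funext => S; rewrite mulnA.
move=> d d_gt0; rewrite sym dilate_Q // => NPd.
suff cd : (c %| d)%N by split=> //; apply: dvdn_leq.
rewrite hc; apply/lcm_denominators_dvd => j i.
(* Dilation carries [v j] to an extreme point of a hull of lattice points, so [d%:R *: v j] is
   itself a lattice point. *)
have /(tight_vertex_scale _ _ d_gt0)/tight_vertexP : tight_vertex b (v j).
  by apply/vP; exists j.
rewrite -NPd => /extreme_point_hull[m _ mE].
have [w vw] := vrat j; rewrite vw mxE denominator_ratr.
apply: (@denq_dvd _ d (m i)); apply: (fmorph_inj (ratr : {rmorphism rat -> R})).
move/rowP: mE => /(_ i); rewrite vw !mxE => mE.
by rewrite rmorphM /= !ratr_nat.
Qed.
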